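(* Let $K$ be a non-Archimedean local field, let $d\ge 1$, let $\mu$ be a Borel probability measure on $K^d$ and let $\Lambda\subset\widehat{K}^d\simeq K^d$. Then $\mu$ is a spectral measure with $\Lambda$ as its spectrum if and only if $$\forall \xi\in\widehat{K}^d,\qquad \sum_{\lambda\in\Lambda}|\widehat{\mu}(\lambda-\xi)|^2=1.$$
   Context: $K$ is a non-discrete, locally compact, disconnected (i.e. non-Archimedean local) field with absolute value $|\cdot|$, ring of integers $\mathfrak{D}=\{x\in K:|x|\le 1\}$, and $\mathfrak{p}$ a prime element (a generator of the maximal ideal $\{|x|<1\}$). Fix a character $\chi$ of $(K,+)$ which is equal to $1$ on $\mathfrak{D}$ and is non-constant on $\mathfrak{p}^{-1}\mathfrak{D}$. For $x,y\in K^d$ put $x\cdot y=\sum_{j} x_jy_j$ and $\chi_y(x)=\chi(y\cdot x)$; the map $y\mapsto\chi_y$ identifies $K^d$ with its dual group $\widehat{K}^d$. The Fourier transform of a finite Borel measure $\mu$ on $K^d$ is $\widehat{\mu}(y)=\int_{K^d}\overline{\chi_y(x)}\,d\mu(x)$. A Borel probability measure $\mu$ on $K^d$ is a spectral measure with spectrum $\Lambda\subset\widehat{K}^d$ if $\{\chi_\lambda\}_{\lambda\in\Lambda}$ is an orthonormal (Hilbert) basis of $L^2(\mu)$. *)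

(* Defs.v *)
From HB Require Import structures.
From mathcomp Require Import all_boot all_order all_algebra.
From mathcomp Require Import all_classical all_reals all_analysis.
From mathcomp Require Import complex.

Set Implicit Arguments.
Unset Strict Implicit.
Unset Printing Implicit Defensive.
Import Order.TTheory GRing.Theory Num.Theory.
Import numFieldNormedType.Exports.

Local Open Scope classical_set_scope.
Local Open Scope ring_scope.
Local Open Scope complex_scope.

HB.mixin Record isTopologicalField K & Topological K & GRing.Field K := {
  mul_continuous : continuous (fun x : K * K => x.1 * x.2) ;
  inv_continuous : forall x : K, x != 0 -> {for x, continuous (@GRing.inv K)}
}.

#[short(type="topologicalFieldType")]
HB.structure Definition TopologicalField :=
  {K of GRing.Field K & TopologicalZmodule K & isTopologicalField K}.

HB.instance Definition _ (K : topologicalFieldType) := isPointed.Build K 0.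

(* A disconnected topological field is automatically Hausdorff: the closure of
   {0} is an ideal, hence it is {0} or the whole (then indiscrete) field. *)
Definition nonarch_local_field (K : topologicalFieldType) : Prop :=
  [/\ ~ (forall x : K, open [set x]),
      locally_compact [set: K] &
      ~ connected [set: K]].

(* The value group is not normalised: any ultrametric absolute value defining
   the topology is allowed, the normalised one in particular. *)
Record nonarch_absolute_value (R : realType) (K : topologicalFieldType)
    (abs : K -> R) : Prop := {
  abs_ge0 : forall x, 0 <= abs x ;
  abs_eq0 : forall x, abs x = 0 <-> x = 0 ;
  absM : forall x y, abs (x * y) = abs x * abs y ;
  abs_ultrametric : forall x y, abs (x + y) <= Num.max (abs x) (abs y) ;
  abs_nbhs : forall (x : K) (U : set K),
    nbhs x U <->
    exists2 e : R, 0 < e & [set y | abs (x - y) < e] `<=` U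
}.

Section local_field.
Context {R : realType} {K : topologicalFieldType}.
Implicit Types (abs : K -> R) (chi : K -> R[i]).

Definition integer_ring abs : set K := [set x | abs x <= 1].

Definition maximal_ideal abs : set K := [set x | abs x < 1].

Definition prime_element abs (p : K) : Prop :=
  maximal_ideal abs = [set p * x | x in integer_ring abs].

Record additive_character chi : Prop := {
  character_continuous : continuous (chi : K -> R[i]^o) ;
  characterD : forall x y, chi (x + y) = chi x * chi y ;
  character_norm : forall x, `|chi x| = 1
}.

Definition nonconstant_on (A : set K) chi : Prop :=
  exists x y, [/\ A x, A y & chi x <> chi y].

Definition dot d (x y : 'rV[K]_d) : K := \sum_(j < d) x 0 j * y 0 j.

Definition vchar chi d (y : 'rV[K]_d) : 'rV[K]_d -> R[i] :=
  fun x => chi (dot y x).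

End local_field.

Definition borel (T : ptopologicalType) := g_sigma_algebraType (@open T).
HB.instance Definition _ (T : ptopologicalType) := Measurable.on (borel T).

Section complex_L2.
Context {d : measure_display} {T : measurableType d} {R : realType}.
Variable mu : {measure set T -> \bar R}.
Implicit Types f g : T -> R[i].

(* `|z| is an element of R[i] with zero imaginary part. *)
Definition modulus (z : R[i]) : R := complex.Re `|z|.

Definition cintegral f : R[i] :=
  Rintegral mu setT (fun x => complex.Re (f x)) +i*
  Rintegral mu setT (fun x => complex.Im (f x)).

Definition cmeasurable f : Prop :=
  measurable_fun setT (fun x => complex.Re (f x)) /\
  measurable_fun setT (fun x => complex.Im (f x)).

Definition L2norm f : \bar R := 'N[mu]_2%:E [EFin \o (modulus \o f)]%E.

Definition L2 : set (T -> R[i]) :=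
  [set f | cmeasurable f /\ (L2norm f < +oo)%E].

Definition L2dot f g : R[i] := cintegral (fun x => f x * (g x)^*).

(* Families are indexed: if e i = e j almost everywhere for some i <> j in A,
   then e is not orthonormal on A. *)
Definition orthonormal_family (I : eqType) (A : set I) (e : I -> T -> R[i]) :
    Prop :=
  [/\ forall i, A i -> L2 (e i),
      forall i, A i -> L2dot (e i) (e i) = 1 &
      forall i j, A i -> A j -> i <> j -> L2dot (e i) (e j) = 0].

(* The linear span of (e i), i in A, is dense in L2. *)
Definition total_family (I : eqType) (A : set I) (e : I -> T -> R[i]) : Prop :=
  forall f, L2 f -> forall eps : R, 0 < eps ->
  exists (s : seq I) (c : I -> R[i]),
    [set` s] `<=` A /\
    (L2norm (fun x => f x - \sum_(i <- s) c i * e i x)%R < eps%:E)%E.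

Definition hilbert_basis (I : eqType) (A : set I) (e : I -> T -> R[i]) : Prop :=
  orthonormal_family A e /\ total_family A e.

End complex_L2.

(* The dual group of K^n is identified with K^n through y |-> vchar chi y, so
   frequencies are row vectors. *)
Section spectral.
Context {R : realType} {K : topologicalFieldType}.
Variables (chi : K -> R[i]) (n : nat).
Variable mu : probability (borel 'rV[K]_n) R.

Definition fourier (y : 'rV[K]_n) : R[i] :=
  cintegral mu (fun x => (vchar chi y x)^*).

Definition spectrum (L : set 'rV[K]_n) : Prop :=
  hilbert_basis mu L (vchar chi (d := n)).

End spectral.

(* Main.v *)
Require Import Defs.
From HB Require Import structures.
From mathcomp Require Import all_boot all_order all_algebra.
From mathcomp Require Import all_classical all_reals all_analysis.
From mathcomp Require Import complex.
From mathcomp Require Import measurable_realfun ring lra.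

Import Order.TTheory GRing.Theory Num.Theory.
Import numFieldNormedType.Exports.

Local Open Scope classical_set_scope.
Local Open Scope ring_scope.
Local Open Scope complex_scope.

Set Implicit Arguments.
Unset Strict Implicit.
Unset Printing Implicit Defensive.

(** The characters [vchar chi xi] have modulus 1, hence norm 1, and the inner
    product of those of frequencies [xi] and [lambda] is the Fourier transform
    of the measure at [lambda - xi].  The sum in the theorem is thus the sum of
    the squared Fourier coefficients of [vchar chi xi] with respect to the
    characters of frequencies in [Lambda], and the statement to prove is
    Parseval's criterion restricted to the characters.

    If the characters of frequencies in [Lambda] form a Hilbert basis, the sum
    is 1 by Parseval's identity ([hilbert_basis_parseval]).  Conversely, for
    [xi] in [Lambda] the term [lambda = xi] of the sum is already 1, so the
    other terms vanish: the family is orthonormal.  Then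
    [mean_square_error] shows that the distance from an arbitrary character to
    the span of the family is 0, and totality of the family follows from that
    of the family of all characters ([parseval_hilbert_basis]).

    It remains to see that the characters span a dense subspace of [L^2]
    ([vchar_total]), for an arbitrary Borel probability measure.  The closed
    span of the characters is stable under multiplication by characters, hence
    under multiplication by [((1 + m) / 2) ^+ n] where [m] is a character times
    a constant of modulus 1.  These functions are bounded by 1 and tend to the
    indicator of [m = 1], so the closed span is stable under multiplication by
    such an indicator ([stable_eq1]).  The sets whose indicator preserves a
    closed subspace form a sigma-algebra ([stable_sigma_algebra]).  The sets
    [m = 1] generate the Borel sets ([open_generated]): the ring of integers is
    the set of [z] such that [chi (y * z) = 1] for all integers [y], and [y]
    may be restricted to a countable dense set because a local field is
    separable.  Hence the closed span contains the indicators of all Borel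
    sets, and these span a dense subspace. *)

(** * Squared modulus and mean square norm *)

Section complex_numbers.
Context {R : realType}.
Implicit Types z w : R[i].

Definition sqmod z : R := complex.Re z ^+ 2 + complex.Im z ^+ 2.

Lemma modulusE z : modulus z = Num.sqrt (sqmod z).
Proof. by rewrite /modulus normc_def. Qed.

Lemma sqmod_ge0 z : 0 <= sqmod z.
Proof. by rewrite addr_ge0 ?sqr_ge0. Qed.

Lemma modulus_ge0 z : 0 <= modulus z.
Proof. by rewrite modulusE sqrtr_ge0. Qed.

Lemma sqr_modulus z : modulus z ^+ 2 = sqmod z.
Proof. by rewrite modulusE sqr_sqrtr ?sqmod_ge0. Qed.

Lemma cReD z w : complex.Re (z + w) = complex.Re z + complex.Re w.
Proof. by case: z; case: w. Qed.

Lemma cImD z w : complex.Im (z + w) = complex.Im z + complex.Im w.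
Proof. by case: z; case: w. Qed.

Lemma cReM z w : complex.Re (z * w) =
  complex.Re z * complex.Re w - complex.Im z * complex.Im w.
Proof. by case: z; case: w. Qed.

Lemma cImM z w : complex.Im (z * w) =
  complex.Re z * complex.Im w + complex.Im z * complex.Re w.
Proof. by case: z; case: w. Qed.

Lemma cReN z : complex.Re (- z) = - complex.Re z. Proof. by case: z. Qed.
Lemma cImN z : complex.Im (- z) = - complex.Im z. Proof. by case: z. Qed.
Lemma cReJ z : complex.Re z^* = complex.Re z. Proof. by case: z. Qed.
Lemma cImJ z : complex.Im z^* = - complex.Im z. Proof. by case: z. Qed.

Definition cReImE := (cReD, cImD, cReM, cImM, cReN, cImN, cReJ, cImJ).

Lemma sqmodM z w : sqmod (z * w) = sqmod z * sqmod w.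
Proof. by rewrite /sqmod !cReImE; ring. Qed.

Lemma sqmodN z : sqmod (- z) = sqmod z.
Proof. by rewrite /sqmod !cReImE; ring. Qed.

Lemma sqmodJ z : sqmod z^* = sqmod z.
Proof. by rewrite /sqmod !cReImE; ring. Qed.

Lemma sqmod0 : sqmod 0 = 0.
Proof. by rewrite /sqmod /= expr0n addr0. Qed.

Lemma sqmodR (r : R) : sqmod r%:C = r ^+ 2.
Proof. by rewrite /sqmod /= expr0n addr0. Qed.

Lemma sqmod1 : sqmod 1 = 1.
Proof. by rewrite (sqmodR 1) expr1n. Qed.

Lemma sqmod_exp z n : sqmod (z ^+ n) = sqmod z ^+ n.
Proof. by elim: n => [|n IH]; rewrite ?expr0 ?sqmod1// !exprS sqmodM IH. Qed.

Lemma sqmodD_le z w : sqmod (z + w) <= 2 * (sqmod z + sqmod w).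
Proof.
rewrite /sqmod !cReImE.
have := sqr_ge0 (complex.Re z - complex.Re w).
have := sqr_ge0 (complex.Im z - complex.Im w).
by nra.
Qed.

Lemma mulcJ z : z * z^* = (sqmod z)%:C.
Proof.
case: z => a b; apply/eqP; rewrite eq_complex /sqmod /=.
by apply/andP; split; apply/eqP; ring.
Qed.

Lemma cJM z w : (z * w)^* = z^* * w^*.
Proof. exact: rmorphM. Qed.

Lemma norm1_sqmod z : `|z| = 1 -> sqmod z = 1.
Proof. by rewrite -sqr_modulus /modulus => ->; rewrite expr1n. Qed.

Lemma sqmod_eq0 z : sqmod z = 0 -> z = 0.
Proof.
move=> /eqP; rewrite /sqmod paddr_eq0 ?sqr_ge0// !sqrf_eq0 => /andP[a b].
by apply/eqP; rewrite eq_complex a b.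
Qed.

(** By strict convexity of the disc.  The powers of [(1 + z) / 2] therefore
    tend to 0 unless [z = 1]. *)
Lemma sqmod_mid_lt1 z : sqmod z = 1 -> z != 1 -> sqmod ((1 + z) * (2^-1)%:C) < 1.
Proof.
case: z => a b; rewrite sqmodM sqmodR eq_complex /sqmod /= => ab1.
rewrite negb_and => abN1; have a1 : a < 1.
  rewrite lt_neqAle; apply/andP; split; last by nra.
  case/orP: abN1 => // b0; apply/eqP => a1; move: b0.
  by rewrite -sqrf_eq0; apply/negP; rewrite negbK; apply/eqP; nra.
have := ab1; nra.
Qed.

End complex_numbers.

Section measurable_complex.
Context {d : measure_display} {T : measurableType d} {R : realType}.
Implicit Types f g : T -> R[i].

Lemma cmeasurable_cst (c : R[i]) : cmeasurable (fun _ : T => c).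
Proof. by split; exact: measurable_cst. Qed.

Lemma cmeasurableD f g : cmeasurable f -> cmeasurable g ->
  cmeasurable (fun x => f x + g x).
Proof.
move=> [f1 f2] [g1 g2]; split.
  by under eq_fun do rewrite cReD; exact: measurable_funD.
by under eq_fun do rewrite cImD; exact: measurable_funD.
Qed.

Lemma cmeasurableM f g : cmeasurable f -> cmeasurable g ->
  cmeasurable (fun x => f x * g x).
Proof.
move=> [f1 f2] [g1 g2]; split.
  under eq_fun do rewrite cReM.
  by apply: measurable_funB; exact: measurable_funM.
under eq_fun do rewrite cImM.
by apply: measurable_funD; exact: measurable_funM.
Qed.

Lemma cmeasurableN f : cmeasurable f -> cmeasurable (fun x => - f x).
Proof.
move=> [f1 f2]; split.
  by under eq_fun do rewrite cReN; exact: measurableT_comp.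
by under eq_fun do rewrite cImN; exact: measurableT_comp.
Qed.

Lemma cmeasurableB f g : cmeasurable f -> cmeasurable g ->
  cmeasurable (fun x => f x - g x).
Proof. by move=> mf mg; apply/cmeasurableD/cmeasurableN. Qed.

Lemma cmeasurableJ f : cmeasurable f -> cmeasurable (fun x => (f x)^*).
Proof.
move=> [f1 f2]; split; first by under eq_fun do rewrite cReJ.
by under eq_fun do rewrite cImJ; exact: measurableT_comp.
Qed.

Lemma cmeasurable_sum (J : Type) (s : seq J) (h : J -> T -> R[i]) :
  (forall j, cmeasurable (h j)) -> cmeasurable (fun x => \sum_(j <- s) h j x).
Proof.
move=> mh; elim: s => [|j s IH].
  by under eq_fun do rewrite big_nil; exact: cmeasurable_cst.
by under eq_fun do rewrite big_cons; exact: cmeasurableD.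
Qed.

Lemma cmeasurable_real (h : T -> R) :
  measurable_fun setT h -> cmeasurable (fun x => (h x)%:C).
Proof. by split => //; exact: measurable_cst. Qed.

Lemma cmeasurable_indic (A : set T) f : measurable A -> cmeasurable f ->
  cmeasurable (fun x => (\1_A x)%:C * f x).
Proof.
move=> mA mf; apply: cmeasurableM => //.
by apply: cmeasurable_real; exact: measurable_indic.
Qed.

Lemma measurable_sqmod f :
  cmeasurable f -> measurable_fun setT (fun x => sqmod (f x)).
Proof. by move=> [f1 f2]; apply: measurable_funD; exact: measurable_funX. Qed.

End measurable_complex.

Section mean_square.
Context {d : measure_display} {T : measurableType d} {R : realType}.
Variable mu : {measure set T -> \bar R}.
Implicit Types f g h : T -> R[i].

Definition sqint f : \bar R := (\int[mu]_x (sqmod (f x))%:E)%E.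

Lemma sqint_ge0 f : (0 <= sqint f)%E.
Proof. by apply: integral_ge0 => x _; rewrite lee_fin sqmod_ge0. Qed.

Lemma L2normE f : L2norm mu f = (sqint f `^ 2^-1)%E.
Proof.
rewrite /L2norm unlock; congr poweR; apply: eq_integral => x _ /=.
rewrite ger0_norm ?modulus_ge0// -sqr_modulus -powR_mulrn ?modulus_ge0//.
Qed.

Lemma L2norm_lt f (e : R) : 0 < e ->
  (L2norm mu f < e%:E)%E = (sqint f < (e ^+ 2)%:E)%E.
Proof.
move=> e0; rewrite L2normE.
have := sqint_ge0 f; case: (sqint f) => [r| |]//.
  rewrite lee_fin poweR_EFin !lte_fin => r0.
  rewrite powR12_sqrt// -[in LHS](ger0_norm (ltW e0)) -sqrtr_sqr.
  by rewrite ltr_sqrt// exprn_gt0.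
by rewrite poweRyr// ?invr_eq0// ltNge leey.
Qed.

Lemma L2norm_fin f : (L2norm mu f < +oo)%E <-> (sqint f < +oo)%E.
Proof.
by rewrite L2normE; split; [exact: lty_poweRy|exact: poweR_lty].
Qed.

Lemma sqint_le f g : cmeasurable f -> cmeasurable g ->
  (forall x, sqmod (f x) <= sqmod (g x)) -> (sqint f <= sqint g)%E.
Proof.
move=> mf mg fg; apply: ge0_le_integral => //.
- by move=> x _; rewrite lee_fin sqmod_ge0.
- by apply/measurable_EFinP; exact: measurable_sqmod.
- by apply/measurable_EFinP; exact: measurable_sqmod.
- by move=> x _; rewrite lee_fin.
Qed.

Lemma sqintD_le f g : cmeasurable f -> cmeasurable g ->
  (sqint (fun x => f x + g x)%R <= 2%:E * (sqint f + sqint g))%E.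
Proof.
move=> mf mg.
have mf2 : measurable_fun setT (fun x => (sqmod (f x))%:E).
  by apply/measurable_EFinP; exact: measurable_sqmod.
have mg2 : measurable_fun setT (fun x => (sqmod (g x))%:E).
  by apply/measurable_EFinP; exact: measurable_sqmod.
rewrite -ge0_integralD//; last 2 first.
- by move=> x _; rewrite lee_fin sqmod_ge0.
- by move=> x _; rewrite lee_fin sqmod_ge0.
rewrite -ge0_integralZl//; last 2 first.
- by apply: emeasurable_funD.
- by move=> x _; rewrite adde_ge0// lee_fin sqmod_ge0.
apply: ge0_le_integral => //.
- by move=> x _; rewrite lee_fin sqmod_ge0.
- by apply/measurable_EFinP; apply: measurable_sqmod; exact: cmeasurableD.
- by apply: measurable_funeM; exact: emeasurable_funD.
- by move=> x _; rewrite -EFinD -EFinM lee_fin; exact: sqmodD_le.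
Qed.

Lemma sqintZ (c : R[i]) f : cmeasurable f ->
  sqint (fun x => c * f x) = ((sqmod c)%:E * sqint f)%E.
Proof.
move=> mf; rewrite -ge0_integralZl//; last 3 first.
- by apply/measurable_EFinP; exact: measurable_sqmod.
- by move=> x _; rewrite lee_fin sqmod_ge0.
- by rewrite lee_fin sqmod_ge0.
by apply: eq_integral => x _; rewrite sqmodM EFinM.
Qed.

Lemma sqint_sum_fin (J : eqType) (s : seq J) (c : J -> R[i]) (h : J -> T -> R[i]) :
  (forall j, cmeasurable (h j)) -> (forall j, j \in s -> sqint (h j) < +oo)%E ->
  (sqint (fun x => \sum_(j <- s) c j * h j x)%R < +oo)%E.
Proof.
move=> mh; elim: s => [_|j s IH hs].
  rewrite /sqint; under eq_integral do rewrite big_nil sqmod0.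
  by rewrite integral0 ltry.
under eq_fun do rewrite big_cons.
apply: (le_lt_trans (sqintD_le _ _)).
- by apply: cmeasurableM => //; exact: cmeasurable_cst.
- apply: cmeasurable_sum => k; apply: cmeasurableM => //; exact: cmeasurable_cst.
rewrite lte_mul_pinfty// ?lee_fin// lte_add_pinfty//.
  by rewrite sqintZ// lte_mul_pinfty// ?lee_fin ?sqmod_ge0// hs ?mem_head.
by apply: IH => k ks; rewrite hs// inE ks orbT.
Qed.

(** The squared distances are dominated by [4 * sqmod h]. *)
Lemma sqint_dominated (u : nat -> T -> R[i]) f h :
  (forall n, cmeasurable (u n)) -> cmeasurable f -> cmeasurable h ->
  (sqint h < +oo)%E ->
  (forall n x, sqmod (u n x) <= sqmod (h x)) ->
  (forall x, sqmod (f x) <= sqmod (h x)) ->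
  (forall x, (fun n => sqmod (f x - u n x)) @ \oo --> (0 : R)) ->
  forall e : R, 0 < e -> exists n, (sqint (fun x => f x - u n x)%R < e%:E)%E.
Proof.
move=> mu_ mf mh hoo uh fh cvg e e0.
have mB n : measurable_fun setT (fun x => (sqmod (f x - u n x))%:E).
  by apply/measurable_EFinP/measurable_sqmod/cmeasurableB.
have mh2 : measurable_fun setT (fun x => (sqmod (h x))%:E).
  by apply/measurable_EFinP/measurable_sqmod.
have ih : mu.-integrable setT (fun x => (4 * sqmod (h x))%:E).
  under eq_fun do rewrite EFinM.
  apply: integrableZl => //; apply/integrableP; split => //.
  apply: le_lt_trans hoo; rewrite /sqint le_eqVlt; apply/orP; left; apply/eqP.
  by apply: eq_integral => x _ /=; rewrite ger0_norm ?sqmod_ge0.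
have c0 : (fun n => \int[mu]_x (sqmod (f x - u n x)%R)%:E)%E @ \oo -->
    (\int[mu]_x (cst 0 x))%E.
  apply: (@dominated_cvg _ _ _ _ _ _ _ _ (fun x => (4 * sqmod (h x))%:E)%E) => //.
  - by move=> x _ /=; apply: cvg_EFin; [exact: nearW|exact: cvg].
  - move=> n x _ /=; rewrite lee_fin ger0_norm ?sqmod_ge0//.
    apply: le_trans (sqmodD_le _ _) _; rewrite sqmodN.
    by have := uh n x; have := fh x; lra.
move: c0; rewrite integral0 => /fine_cvgP[fin /cvgrPdist_lt /(_ _ e0) near].
near \oo => n; exists n.
have fn : (sqint (fun x => f x - u n x)) \is a fin_num by near: n.
rewrite -(fineK fn) lte_fin.
have : `|0 - fine (sqint (fun x => f x - u n x))| < e by near: n.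
by rewrite sub0r normrN; apply: le_lt_trans; exact: ler_norm.
Unshelve. all: by end_near.
Qed.

End mean_square.

(** * The closed span of a family *)

Section approximation.
Context {d : measure_display} {T : measurableType d} {R : realType}.
Variable mu : {measure set T -> \bar R}.
Implicit Types f g h : T -> R[i].

(** Indices may be repeated, so that the sum of two combinations is given by
    the concatenation of the lists. *)
Definition lincomb (I : Type) (e : I -> T -> R[i]) (s : seq (I * R[i])) :
    T -> R[i] :=
  fun x => \sum_(p <- s) p.2 * e p.1 x.

(** Membership in the closed subspace of [L^2] spanned by the [e i], [i] in
    [S]; the square of the distance is compared with [eps]. *)
Definition approximable (I : eqType) (S : set I) (e : I -> T -> R[i]) f :=
  cmeasurable f /\ forall eps : R, 0 < eps ->
  exists2 s : seq (I * R[i]), (forall p, p \in s -> S p.1) &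
    (sqint mu (fun x => f x - lincomb e s x)%R < eps%:E)%E.

Lemma cmeasurable_lincomb (I : Type) (e : I -> T -> R[i]) s :
  (forall i, cmeasurable (e i)) -> cmeasurable (lincomb e s).
Proof.
move=> me; apply: cmeasurable_sum => p.
by apply: cmeasurableM => //; exact: cmeasurable_cst.
Qed.

Section closed_subspace.
Variables (I : eqType) (S : set I) (e : I -> T -> R[i]).
Hypothesis me : forall i, cmeasurable (e i).
Hypothesis e2 : forall i, S i -> (sqint mu (e i) < +oo)%E.

(** Passing from [f - g] and [g - lincomb e s] to their sum costs a factor 2 in
    the squared norm, hence [eps / 4] for each of them. *)
Lemma approximable_closed f : cmeasurable f ->
  (forall eps : R, 0 < eps -> exists2 g, approximable S e g &
    (sqint mu (fun x => f x - g x)%R < eps%:E)%E) ->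
  approximable S e f.
Proof.
move=> mf fg; split=> // eps eps0.
have e4 : 0 < eps / 4 by rewrite divr_gt0.
have [g [mg gs] fge] := fg _ e4; have [s sS ge] := gs _ e4; exists s => //.
have ms := cmeasurable_lincomb s me.
have -> : (fun x => f x - lincomb e s x) =
    (fun x => (f x - g x) + (g x - lincomb e s x)).
  by apply/funext => x; rewrite addrA subrK.
apply: (le_lt_trans (sqintD_le _ _ _)); [exact: cmeasurableB|exact: cmeasurableB|].
have -> : eps%:E = (2%:E * ((eps / 4)%:E + (eps / 4)%:E))%E.
  by rewrite -EFinD -EFinM; congr EFin; lra.
by rewrite lte_pmul2l// lteD.
Qed.

Lemma approximable_ext f g : f =1 g -> approximable S e f -> approximable S e g.
Proof. by move=> /funext ->. Qed.

Lemma approximable_lincomb s :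
  (forall p, p \in s -> S p.1) -> approximable S e (lincomb e s).
Proof.
move=> sS; split=> [|eps eps0]; first exact: cmeasurable_lincomb.
exists s => //; rewrite /sqint; under eq_integral do rewrite subrr sqmod0.
by rewrite integral0 lte_fin.
Qed.

Lemma approximable_gen i : S i -> approximable S e (e i).
Proof.
move=> Si; apply: (@approximable_ext (lincomb e [:: (i, 1)])) => [x|].
  by rewrite /lincomb big_seq1 mul1r.
by apply: approximable_lincomb => p; rewrite inE => /eqP ->.
Qed.

Lemma approximable0 : approximable S e (fun=> 0).
Proof.
apply: (@approximable_ext (lincomb e [::])) => [x|].
  by rewrite /lincomb big_nil.
exact: approximable_lincomb.
Qed.

Lemma approximableD f g : approximable S e f -> approximable S e g ->
  approximable S e (fun x => f x + g x).
Proof.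
move=> [mf fs] [mg gs]; split=> [|eps eps0]; first exact: cmeasurableD.
have e4 : 0 < eps / 4 by rewrite divr_gt0.
have [s sS se] := fs _ e4; have [t tS te] := gs _ e4; exists (s ++ t).
  by move=> p; rewrite mem_cat => /orP[/sS|/tS].
have -> : (fun x => f x + g x - lincomb e (s ++ t) x) =
    (fun x => (f x - lincomb e s x) + (g x - lincomb e t x)).
  by apply/funext => x; rewrite /lincomb big_cat/= opprD addrACA.
apply: (le_lt_trans (sqintD_le _ _ _)).
- by apply: cmeasurableB => //; exact: cmeasurable_lincomb.
- by apply: cmeasurableB => //; exact: cmeasurable_lincomb.
have -> : eps%:E = (2%:E * ((eps / 4)%:E + (eps / 4)%:E))%E.
  by rewrite -EFinD -EFinM; congr EFin; lra.
by rewrite lte_pmul2l// lteD.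
Qed.

Lemma approximableZ c f :
  approximable S e f -> approximable S e (fun x => c * f x).
Proof.
move=> [mf fs]; split=> [|eps eps0].
  by apply: cmeasurableM => //; exact: cmeasurable_cst.
have c1 : 0 < sqmod c + 1 by rewrite ltr_wpDl ?sqmod_ge0.
have [|s sS se] := fs (eps / (sqmod c + 1)); first by rewrite divr_gt0.
exists [seq (p.1, c * p.2) | p <- s]; first by move=> _ /mapP[p /sS Sp ->].
have -> : (fun x => c * f x - lincomb e [seq (p.1, c * p.2) | p <- s] x) =
    (fun x => c * (f x - lincomb e s x)).
  apply/funext => x; rewrite mulrBr /lincomb big_map mulr_sumr.
  by congr (_ - _); apply: eq_bigr => p _; rewrite mulrA.
rewrite sqintZ; last by apply: cmeasurableB => //; exact: cmeasurable_lincomb.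
apply: (@le_lt_trans _ _ ((sqmod c)%:E * (eps / (sqmod c + 1))%:E)%E).
  by rewrite lee_pmul ?sqint_ge0 ?lee_fin ?sqmod_ge0// ltW.
rewrite -EFinM lte_fin mulrCA gtr_pMr// ltr_pdivrMr// mul1r; lra.
Qed.

Lemma approximableB f g : approximable S e f -> approximable S e g ->
  approximable S e (fun x => f x - g x).
Proof.
move=> af ag; apply: (@approximable_ext (fun x => f x + (-1) * g x)) => [x|].
  by rewrite mulN1r.
by apply: approximableD => //; exact: approximableZ.
Qed.

Lemma approximable_sum (J : eqType) (s : seq J) (h : J -> T -> R[i]) :
  (forall j, j \in s -> approximable S e (h j)) ->
  approximable S e (fun x => \sum_(j <- s) h j x).
Proof.
elim: s => [_|j s IH hs].
  by apply: approximable_ext approximable0 => x; rewrite big_nil.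
apply: (@approximable_ext (fun x => h j x + \sum_(j <- s) h j x)) => [x|].
  by rewrite big_cons.
apply: approximableD; first by apply: hs; rewrite mem_head.
by apply: IH => k ks; apply: hs; rewrite inE ks orbT.
Qed.

Lemma approximable_fin f : approximable S e f -> (sqint mu f < +oo)%E.
Proof.
move=> [mf /(_ 1 ltr01)[s sS se]]; have ms := cmeasurable_lincomb s me.
have -> : f = (fun x => (f x - lincomb e s x) + lincomb e s x).
  by apply/funext => x; rewrite subrK.
apply: (le_lt_trans (sqintD_le _ _ _)) => //; first exact: cmeasurableB.
rewrite lte_mul_pinfty// ?lee_fin// lte_add_pinfty//.
  by apply: (lt_trans se); rewrite ltry.
apply: (@sqint_sum_fin _ _ _ _ _ _ snd (fun p => e p.1)) => // p ps.
by apply: e2; exact: sS.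
Qed.

Lemma approximable_dominated (u : nat -> T -> R[i]) f h :
  (forall n, approximable S e (u n)) -> cmeasurable f -> cmeasurable h ->
  (sqint mu h < +oo)%E ->
  (forall n x, sqmod (u n x) <= sqmod (h x)) ->
  (forall x, sqmod (f x) <= sqmod (h x)) ->
  (forall x, (fun n => sqmod (f x - u n x)) @ \oo --> (0 : R)) ->
  approximable S e f.
Proof.
move=> au mf mh hoo uh fh cvg; apply: approximable_closed => // eps eps0.
have [|n un] := sqint_dominated _ mf mh hoo uh fh cvg eps0; last by exists (u n).
by move=> n; case: (au n).
Qed.

End closed_subspace.

(** Multiplication by [m] is a contraction of [L^2], so it maps a closed span
    into another one as soon as it does so for the generators. *)
Lemma approximable_mul (I J : eqType) (S : set I) (e : I -> T -> R[i])
    (S' : set J) (e' : J -> T -> R[i]) (m : T -> R[i]) f :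
  (forall i, cmeasurable (e i)) -> (forall j, cmeasurable (e' j)) ->
  cmeasurable m -> (forall x, sqmod (m x) <= 1) ->
  (forall i, S i -> approximable S' e' (fun x => m x * e i x)) ->
  approximable S e f -> approximable S' e' (fun x => m x * f x).
Proof.
move=> me me' mm m1 mS [mf fs].
apply: approximable_closed => // [|eps eps0]; first exact: cmeasurableM.
have [s sS se] := fs _ eps0; exists (fun x => m x * lincomb e s x).
  apply: (@approximable_ext _ _ _
      (fun x => \sum_(p <- s) p.2 * (m x * e p.1 x))) => [x|].
    by rewrite mulr_sumr; apply: eq_bigr => p _; rewrite mulrCA.
  by apply: approximable_sum => // p ps; apply: approximableZ => //; exact/mS/sS.
have ms := cmeasurable_lincomb s me.
apply: le_lt_trans se; apply: sqint_le => [||x].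
- by apply: cmeasurableB; exact: cmeasurableM.
- exact: cmeasurableB.
- by rewrite -mulrBr sqmodM ler_piMl ?sqmod_ge0.
Qed.

(** * Sets whose indicator preserves a closed span *)

Section stable_sets.
Import HBNNSimple.
Variables (I : eqType) (S : set I) (e : I -> T -> R[i]).
Hypothesis me : forall i, cmeasurable (e i).
Hypothesis e2 : forall i, S i -> (sqint mu (e i) < +oo)%E.

(** Multiplications compose, so that stability under intersections is
    immediate and stable sets form a sigma-algebra without any recourse to a
    generating family closed under intersections. *)
Definition stable_set (A : set T) := measurable A /\
  forall f, approximable S e f -> approximable S e (fun x => (\1_A x)%:C * f x).

Lemma sqmod_indic_le1 (A : set T) x : sqmod (\1_A x)%:C <= 1 :> R.
Proof. by rewrite sqmodR indicE; case: (_ \in _); rewrite /= ?expr1n ?expr0n. Qed.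

Lemma stable_setC (A : set T) : stable_set A -> stable_set (~` A).
Proof.
move=> [mA sA]; split=> [|f af]; first exact: measurableC.
apply: (@approximable_ext _ _ _ (fun x => f x - (\1_A x)%:C * f x)) => [x|].
  rewrite !indicE in_setC; case: (_ \in _) => /=; first by rewrite mul1r mul0r subrr.
  by rewrite mul1r mul0r subr0.
by apply: approximableB => //; exact: sA.
Qed.

(** Multiply by the indicators of the [F k] one after the other: at each point
    the partial products are eventually constant. *)
Lemma stable_bigcap (F : nat -> set T) :
  (forall n, stable_set (F n)) -> stable_set (\bigcap_n F n).
Proof.
move=> sF; split=> [|f af]; first by apply: bigcapT_measurable => n; case: (sF n).
have [mf _] := af.
pose u n x := (\1_(\bigcap_(k in [set k | (k < n)%N]) F k) x)%:C * f x : R[i].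
have au n : approximable S e (u n).
  elim: n => [|n IH].
    apply: approximable_ext af => x; rewrite /u indicE mem_set ?mul1r//.
  apply: approximable_ext ((sF n).2 _ IH) => x; rewrite /u mulrA -rmorphM.
  congr (_%:C * _).
  have -> : \bigcap_(k in [set k | (k < n.+1)%N]) F k =
      F n `&` \bigcap_(k in [set k | (k < n)%N]) F k.
    apply/seteqP; split=> [y Fy|y [Fn Fy] k /=].
      by split=> [|k kn]; apply: Fy => //=; exact: ltnW.
    by rewrite ltnS leq_eqVlt => /orP[/eqP ->//|]; exact: Fy.
  by rewrite indicI.
have mI : measurable (\bigcap_n F n).
  by apply: bigcapT_measurable => n; case: (sF n).
apply: (approximable_dominated me au _ mf) => //.
- exact: cmeasurable_indic.
- exact: approximable_fin af.
- by move=> n x; rewrite sqmodM ler_piMl ?sqmod_ge0 ?sqmod_indic_le1.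
- by move=> x; rewrite sqmodM ler_piMl ?sqmod_ge0 ?sqmod_indic_le1.
move=> x; have [Fx|] := pselect ((\bigcap_n F n) x).
  apply: cvg_near_cst; apply: nearW => n; rewrite /u !indicE !mem_set ?subrr ?sqmod0//.
  by move=> k _; exact: Fx.
move=> /[dup] nF /existsNP[k /not_implyP[_ Fk]].
apply: cvg_near_cst; exists k.+1 => // n /= kn.
rewrite /u !indicE !memNset ?subrr ?sqmod0// => /(_ k kn); exact: Fk.
Qed.

Lemma stable_sigma_algebra : sigma_algebra setT stable_set.
Proof.
have sC : forall A, stable_set A -> stable_set (~` A) by exact: stable_setC.
split.
- split=> // f _; apply: approximable_ext (approximable0 _ me) => x.
  by rewrite indicE in_set0 mul0r.
- by move=> A; rewrite setTD; exact: sC.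
- move=> F sF; rewrite -[X in stable_set X]setCK setC_bigcup.
  by apply/sC/stable_bigcap => n; exact/sC/sF.
Qed.

(** The powers of [(1 + m) / 2] are bounded by 1 and converge to the indicator
    of [m = 1]. *)
Lemma stable_eq1 (m : T -> R[i]) : cmeasurable m ->
  (forall x, sqmod (m x) = 1) ->
  (forall f, approximable S e f -> approximable S e (fun x => m x * f x)) ->
  measurable [set x | m x = 1] -> stable_set [set x | m x = 1].
Proof.
move=> mm m1 am mE; split=> // f af; have [mf _] := af.
pose w x := (1 + m x) * (2^-1)%:C : R[i].
have w1 x : sqmod (w x) <= 1.
  have [mx|mx] := eqVneq (m x) 1; last exact/ltW/sqmod_mid_lt1.
  rewrite /w mx sqmodM sqmodR.
  have -> : sqmod (1 + 1 : R[i]) = 4 by rewrite /sqmod /=; ring.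
  lra.
have wn1 n x : sqmod (w x ^+ n) <= 1.
  by rewrite sqmod_exp exprn_ile1// sqmod_ge0.
pose u n x := w x ^+ n * f x.
have au n : approximable S e (u n).
  elim: n => [|n IH]; first by apply: approximable_ext af => x; rewrite /u mul1r.
  apply: (@approximable_ext _ _ _
      (fun x => (2^-1)%:C * (u n x + m x * u n x))) => [x|].
    by rewrite /u exprS /w; ring.
  by apply/approximableZ/approximableD => //; exact: am.
apply: (approximable_dominated me au _ mf) => //.
- exact: cmeasurable_indic.
- exact: approximable_fin af.
- by move=> n x; rewrite sqmodM ler_piMl ?sqmod_ge0.
- by move=> x; rewrite sqmodM ler_piMl ?sqmod_ge0 ?sqmod_indic_le1.
move=> x; have [mx|mx] := eqVneq (m x) 1.
  apply: cvg_near_cst; apply: nearW => n.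
  rewrite /u indicE mem_set// /w mx; have -> : (1 + 1) * (2^-1)%:C = 1 :> R[i].
    by apply/eqP; rewrite eq_complex /=; apply/andP; split; apply/eqP; field.
  by rewrite expr1n subrr sqmod0.
have -> : (fun n => sqmod ((\1_[set x | m x = 1] x)%:C * f x - u n x)) =
    (fun n => sqmod (w x) ^+ n * sqmod (f x)).
  apply/funext => n; rewrite indicE memNset /=; last exact/eqP.
  by rewrite mul0r sub0r sqmodN sqmodM sqmod_exp.
rewrite -[X in _ --> X](mul0r (sqmod (f x))); apply: cvgMl; apply: cvg_expr.
by rewrite ger0_norm ?sqmod_ge0 ?sqmod_mid_lt1.
Qed.

(** The closed span contains the simple functions, hence by dominated
    convergence the nonnegative functions of [L^2], and any function of [L^2]
    is a combination of four of these. *)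
Lemma stable_total : approximable S e (fun=> 1) ->
  (forall A, measurable A -> stable_set A) ->
  forall f, cmeasurable f -> (sqint mu f < +oo)%E -> approximable S e f.
Proof.
move=> a1 sm.
have aI A : measurable A -> approximable S e (fun x => (\1_A x)%:C).
  move=> /sm[_ /(_ _ a1)]; apply: approximable_ext => x; exact: mulr1.
have aN (g : {nnsfun T >-> R}) : approximable S e (fun x => (g x)%:C).
  pose s : seq R := finmap.enum_fset (fset_set (range g)).
  apply: (@approximable_ext _ _ _
    (fun x => \sum_(y <- s) y%:C * (\1_(g @^-1` [set y]) x)%:C)) => [x|].
    rewrite [in RHS]fimfunE fsbig_finite//= rmorph_sum /=.
    by apply: eq_bigr => y _; rewrite rmorphM.
  by apply: approximable_sum => // y _; apply: approximableZ => //; exact: aI.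
have aP (h : T -> R) : measurable_fun setT h -> (forall x, 0 <= h x) ->
    (sqint mu (fun x => (h x)%:C) < +oo)%E -> approximable S e (fun x => (h x)%:C).
  move=> mh h0 hoo.
  have mEh : measurable_fun setT (EFin \o h) by apply/measurable_EFinP.
  pose g := nnsfun_approx measurableT mEh.
  have gh n x : g n x <= h x.
    rewrite nnsfun_approxE -lee_fin.
    by apply: (le_approx (f := EFin \o h)) => // y _; rewrite lee_fin.
  have mhC := cmeasurable_real mh.
  apply: (approximable_dominated me (fun n => aN (g n)) _ mhC) => //.
    by move=> n x; rewrite !sqmodR ler_sqr ?nnegrE ?h0 ?gh// fun_ge0.
  move=> x; have -> : (fun n => sqmod ((h x)%:C - (g n x)%:C)) =
      (fun n => (h x - g n x) ^+ 2).
    by apply/funext => n; rewrite -rmorphB sqmodR.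
  have cg : (fun n => g n x) @ \oo --> h x.
    have : (g n x)%:E @[n --> \oo] --> (h x)%:E.
      by apply: (cvg_nnsfun_approx measurableT mEh) => // y _; rewrite lee_fin.
    by move/fine_cvgP => [].
  have -> : (0 : R) = (h x - h x) * (h x - h x) by rewrite subrr mul0r.
  by under eq_fun do rewrite expr2; apply: cvgM; apply: cvgB => //; exact: cvg_cst.
have aR (h : T -> R) : measurable_fun setT h ->
    (sqint mu (fun x => (h x)%:C) < +oo)%E -> approximable S e (fun x => (h x)%:C).
  move=> mh hoo.
  have mp : measurable_fun setT (fun x => Num.max (h x) 0).
    by apply: measurable_maxr => //; exact: measurable_cst.
  have mn : measurable_fun setT (fun x => Num.max (- h x) 0).
    by apply: measurable_maxr; [exact: measurableT_comp|exact: measurable_cst].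
  apply: (@approximable_ext _ _ _
      (fun x => (Num.max (h x) 0)%:C - (Num.max (- h x) 0)%:C)) => [x|].
    rewrite -rmorphB; congr (_%:C); rewrite /Num.max.
    by case: ifP => h1; case: ifP => h2; lra.
  apply: approximableB => //; apply: aP => //.
  - by move=> x; rewrite le_max lexx orbT.
  - apply: le_lt_trans hoo; apply: sqint_le; try exact: cmeasurable_real.
    move=> x; rewrite !sqmodR; have := sqr_ge0 (h x).
    by case: (leP 0 (h x)) => hx; nra.
  - by move=> x; rewrite le_max lexx orbT.
  - apply: le_lt_trans hoo; apply: sqint_le; try exact: cmeasurable_real.
    move=> x; rewrite !sqmodR; have := sqr_ge0 (h x).
    by case: (leP 0 (- h x)) => hx; nra.
move=> f [f1 f2] foo; have mf : cmeasurable f by [].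
apply: (@approximable_ext _ _ _
    (fun x => (complex.Re (f x))%:C + 'i * (complex.Im (f x))%:C)) => [x|].
  by rewrite [RHS]complexE.
apply: approximableD => //; last apply: approximableZ => //; apply: aR => //.
- apply: le_lt_trans foo; apply: sqint_le => //.
  by move=> x; rewrite sqmodR lerDl sqr_ge0.
- apply: le_lt_trans foo; apply: sqint_le => //.
  by move=> x; rewrite sqmodR lerDr sqr_ge0.
Qed.

End stable_sets.

End approximation.

(** * Parseval's criterion for families of unimodular functions *)

Section finite_sums.
Context {R : realType} {I : choiceType}.
Implicit Types (S : set I) (s : seq I) (a : I -> R).

Lemma esum_ge_seq S s a : uniq s -> [set` s] `<=` S ->
  ((\sum_(i <- s) a i)%:E <= \esum_(i in S) (a i)%:E)%E.
Proof.
move=> us sS; apply: esum_ge; exists [set` s]; first by split.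
by rewrite -fsbig_seq// sumEFin.
Qed.

Lemma esum_gt_seq S a (y : \bar R) : (y < \esum_(i in S) (a i)%:E)%E ->
  exists s, [/\ uniq s, [set` s] `<=` S & (y < (\sum_(i <- s) a i)%:E)%E].
Proof.
move=> /ereal_sup_gt[_ [A [fA AS] <-]].
rewrite fsbig_finite//= sumEFin => yA.
exists (finmap.enum_fset (fset_set A)); split=> // i /=.
by rewrite in_fset_set// inE => /AS.
Qed.

Lemma esum_le_seq S a (y : \bar R) :
  (forall s, uniq s -> [set` s] `<=` S -> ((\sum_(i <- s) a i)%:E <= y)%E) ->
  (\esum_(i in S) (a i)%:E <= y)%E.
Proof.
by move=> h; rewrite leNgt; apply/negP => /esum_gt_seq[s [us sS]]; rewrite ltNge h.
Qed.

End finite_sums.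

Section inner_product.
Context {d : measure_display} {T : measurableType d} {R : realType}.
Variable mu : probability T R.
Implicit Types f g h : T -> R[i].

(** All the inner products needed are taken in this algebra: the measure being
    finite, its members are integrable, so that integration is linear there
    without further conditions. *)
Definition bounded_cmeasurable f :=
  cmeasurable f /\ exists M : R, forall x, sqmod (f x) <= M.

Lemma unimodular_bounded f : cmeasurable f -> (forall x, sqmod (f x) = 1) ->
  bounded_cmeasurable f.
Proof. by move=> mf f1; split=> //; exists 1 => x; rewrite f1. Qed.

Lemma bounded_cmeasurable_cst (c : R[i]) : bounded_cmeasurable (fun=> c).
Proof. by split; [exact: cmeasurable_cst|exists (sqmod c)]. Qed.

Lemma bounded_cmeasurableD f g : bounded_cmeasurable f ->
  bounded_cmeasurable g -> bounded_cmeasurable (fun x => f x + g x).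
Proof.
move=> [mf [M fM]] [mg [N gN]]; split; first exact: cmeasurableD.
exists (2 * (M + N)) => x; apply: le_trans (sqmodD_le _ _) _.
by rewrite ler_pM2l// lerD.
Qed.

Lemma bounded_cmeasurableM f g : bounded_cmeasurable f ->
  bounded_cmeasurable g -> bounded_cmeasurable (fun x => f x * g x).
Proof.
move=> [mf [M fM]] [mg [N gN]]; split; first exact: cmeasurableM.
by exists (M * N) => x; rewrite sqmodM ler_pM// sqmod_ge0.
Qed.

Lemma bounded_cmeasurableJ f :
  bounded_cmeasurable f -> bounded_cmeasurable (fun x => (f x)^*).
Proof.
move=> [mf [M fM]]; split; first exact: cmeasurableJ.
by exists M => x; rewrite sqmodJ.
Qed.

Lemma bounded_cmeasurableZ (c : R[i]) f :
  bounded_cmeasurable f -> bounded_cmeasurable (fun x => c * f x).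
Proof. exact/bounded_cmeasurableM/bounded_cmeasurable_cst. Qed.

Lemma bounded_cmeasurable_sqint f :
  bounded_cmeasurable f -> (sqint mu f < +oo)%E.
Proof.
move=> [mf [M fM]]; rewrite /sqint.
apply: (@le_lt_trans _ _ (\int[mu]_x (cst (`|M|%:E) x))%E).
  apply: ge0_le_integral => //.
  - by move=> x _; rewrite lee_fin sqmod_ge0.
  - by apply/measurable_EFinP; exact: measurable_sqmod.
  - by move=> x _; rewrite lee_fin (le_trans (fM x))// ler_norm.
by rewrite integral_cst// [X in (_ * X)%E](@probability_setT _ _ _ mu) mule1 ltry.
Qed.

Lemma integrable_Re_Im f : bounded_cmeasurable f ->
  mu.-integrable setT (EFin \o (fun x => complex.Re (f x))) /\
  mu.-integrable setT (EFin \o (fun x => complex.Im (f x))).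
Proof.
move=> [[f1 f2] [M fM]].
have iM : mu.-integrable setT (EFin \o cst (`|M| + 1)).
  exact: finite_measure_integrable_cst.
have bnd (y : R) x : y ^+ 2 <= sqmod (f x) -> (`|y%:E| <= `|(`|M| + 1)%:E|)%E.
  move=> yf; rewrite !abse_EFin lee_fin.
  have yM : y ^+ 2 <= `|M| by rewrite (le_trans yf)// (le_trans (fM x))// ler_norm.
  rewrite (ger0_norm (addr_ge0 (normr_ge0 M) ler01)).
  by rewrite ler_norml; apply/andP; split; nra.
split; apply: le_integrable iM => //.
- exact/measurable_EFinP.
- by move=> x _; apply: (bnd _ x); rewrite lerDl sqr_ge0.
- exact/measurable_EFinP.
- by move=> x _; apply: (bnd _ x); rewrite lerDr sqr_ge0.
Qed.

Lemma cintegralD f g : bounded_cmeasurable f -> bounded_cmeasurable g ->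
  cintegral mu (fun x => f x + g x) = cintegral mu f + cintegral mu g.
Proof.
move=> /integrable_Re_Im[f1 f2] /integrable_Re_Im[g1 g2].
apply/eqP; rewrite eq_complex /cintegral /=.
under eq_Rintegral do rewrite cReD.
under [X in _ && (X == _)]eq_Rintegral do rewrite cImD.
by rewrite !RintegralD// !eqxx.
Qed.

Lemma cintegralZ (c : R[i]) f : bounded_cmeasurable f ->
  cintegral mu (fun x => c * f x) = c * cintegral mu f.
Proof.
move=> /integrable_Re_Im[f1 f2].
have iZ (r : R) (h : T -> R) : mu.-integrable setT (EFin \o h) ->
    mu.-integrable setT (EFin \o (fun x => r * h x)).
  exact: integrableZl.
apply/eqP; rewrite eq_complex /cintegral cReM cImM /=.
rewrite (eq_Rintegral _ (fun x _ => cReM c (f x))).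
rewrite (eq_Rintegral _ (fun x _ => cImM c (f x))).
rewrite RintegralB//; [|exact: iZ..].
by rewrite RintegralD ?RintegralZl// ?eqxx//; exact: iZ.
Qed.

Lemma cintegralJ f : bounded_cmeasurable f ->
  cintegral mu (fun x => (f x)^*) = (cintegral mu f)^*.
Proof.
move=> /integrable_Re_Im[f1 f2].
apply/eqP; rewrite eq_complex /cintegral /=.
under eq_Rintegral do rewrite cReJ.
under [X in _ && (X == _)]eq_Rintegral do rewrite cImJ -mulN1r.
by rewrite RintegralZl// mulN1r !eqxx.
Qed.

Lemma sqint_L2dot f : bounded_cmeasurable f ->
  sqint mu f = (complex.Re (L2dot mu f f))%:E.
Proof.
move=> bf; rewrite /L2dot /= /Rintegral.
under [in RHS]eq_integral do rewrite mulcJ /=.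
rewrite fineK// ge0_fin_numE ?sqint_ge0//; exact: bounded_cmeasurable_sqint.
Qed.

Lemma L2dotC f g : bounded_cmeasurable f -> bounded_cmeasurable g ->
  L2dot mu g f = (L2dot mu f g)^*.
Proof.
move=> bf bg; rewrite /L2dot -cintegralJ.
  by congr cintegral; apply/funext => x; rewrite cJM conjCK mulrC.
exact/bounded_cmeasurableM/bounded_cmeasurableJ.
Qed.

Lemma L2dotBZl f g h (b : R[i]) : bounded_cmeasurable f ->
  bounded_cmeasurable g -> bounded_cmeasurable h ->
  L2dot mu (fun x => f x - b * g x) h = L2dot mu f h - b * L2dot mu g h.
Proof.
move=> bf bg bh; have bJ := bounded_cmeasurableJ bh.
rewrite /L2dot -mulNr -cintegralZ; last exact: bounded_cmeasurableM.
rewrite -cintegralD; [|exact: bounded_cmeasurableM|].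
  by congr cintegral; apply/funext => x; rewrite mulrBl mulNr mulrA.
exact/bounded_cmeasurableZ/bounded_cmeasurableM.
Qed.

Lemma bounded_cmeasurableBZ f g (b : R[i]) : bounded_cmeasurable f ->
  bounded_cmeasurable g -> bounded_cmeasurable (fun x => f x - b * g x).
Proof.
move=> bf bg; under eq_fun do rewrite -mulNr.
exact/bounded_cmeasurableD/bounded_cmeasurableZ.
Qed.

(** Complete the square in [b]. *)
Lemma L2dot_unit_error f g (b : R[i]) : bounded_cmeasurable f ->
  bounded_cmeasurable g -> L2dot mu g g = 1 ->
  complex.Re (L2dot mu (fun x => f x - b * g x) (fun x => f x - b * g x)) =
  complex.Re (L2dot mu f f) - sqmod (L2dot mu f g) + sqmod (b - L2dot mu f g).
Proof.
move=> bf bg g1; have bh := bounded_cmeasurableBZ b bf bg.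
rewrite L2dotBZl// !(@L2dotC (fun x => f x - b * g x))// !L2dotBZl// g1 mulr1.
rewrite (@L2dotC f g)//.
move: (L2dot mu f f) (L2dot mu f g) => [u v] [w z]; case: b {bh} => p q.
by rewrite /sqmod /=; ring.
Qed.

(** Distance to the point with coordinates [b] in the span of an orthonormal
    family: the best choice of [b] is the family of Fourier coefficients.  The
    vectors are subtracted one at a time, which leaves the remaining Fourier
    coefficients of [f] unchanged. *)
Lemma mean_square_error (I : eqType) (e : I -> T -> R[i]) (s : seq I)
    (b : I -> R[i]) f :
  bounded_cmeasurable f -> (forall i, bounded_cmeasurable (e i)) -> uniq s ->
  (forall i, i \in s -> L2dot mu (e i) (e i) = 1) ->
  (forall i j, i \in s -> j \in s -> i <> j -> L2dot mu (e i) (e j) = 0) ->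
  sqint mu (fun x => f x - \sum_(i <- s) b i * e i x) =
  (complex.Re (L2dot mu f f) - \sum_(i <- s) sqmod (L2dot mu f (e i)) +
   \sum_(i <- s) sqmod (b i - L2dot mu f (e i)))%:E.
Proof.
move=> + be; elim: s f => [|i s IH] f bf us e1 e0.
  rewrite !big_nil subr0 addr0 -sqint_L2dot//.
  by congr sqint; apply/funext => x; rewrite big_nil subr0.
move: us => /andP[si us]; have bh := bounded_cmeasurableBZ (b i) bf (be i).
have -> : (fun x => f x - \sum_(i <- i :: s) b i * e i x) =
    (fun x => (f x - b i * e i x) - \sum_(i <- s) b i * e i x).
  by apply/funext => x; rewrite big_cons opprD addrA.
have dot_e j : j \in s ->
    L2dot mu (fun x => f x - b i * e i x) (e j) = L2dot mu f (e j).
  move=> js; rewrite L2dotBZl// e0 ?mulr0 ?subr0//.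
  - by rewrite mem_head.
  - by rewrite inE js orbT.
  - by move=> ij; rewrite ij js in si.
rewrite IH//; last 2 first.
- by move=> j js; rewrite e1// inE js orbT.
- by move=> j k js ks; apply: e0; rewrite inE ?js ?ks orbT.
rewrite !big_cons L2dot_unit_error// ?e1 ?mem_head//.
have -> : \sum_(j <- s) sqmod (L2dot mu (fun x => f x - b i * e i x) (e j)) =
    \sum_(j <- s) sqmod (L2dot mu f (e j)).
  by apply: eq_big_seq => j js; rewrite dot_e.
have -> : \sum_(j <- s) sqmod (b j - L2dot mu (fun x => f x - b i * e i x) (e j)) =
    \sum_(j <- s) sqmod (b j - L2dot mu f (e j)).
  by apply: eq_big_seq => j js; rewrite dot_e.
by apply: (congr1 EFin); ring.
Qed.

Lemma sum_undup (I : eqType) (s : seq I) (h : I -> R[i]) :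
  \sum_(i <- s) h i = \sum_(i <- undup s) (count_mem i s)%:R * h i.
Proof.
rewrite -big_undup_iterop_count; apply: eq_bigr => i _.
by rewrite mulr_natl; case: (count_mem i s).
Qed.

(** Totality of a family is expressed with one coefficient per index: collect
    the coefficients of repeated indices. *)
Lemma lincomb_undup (I : eqType) (e : I -> T -> R[i]) (s : seq (I * R[i])) :
  lincomb e s = (fun x => \sum_(i <- undup (map fst s))
    (\sum_(p <- s | p.1 == i) p.2) * e i x).
Proof.
apply/funext => x; under eq_bigr do rewrite mulr_suml.
under eq_bigr do rewrite big_mkcond /=.
rewrite exchange_big /=; apply: eq_big_seq => p ps.
rewrite (bigD1_seq p.1) ?undup_uniq ?mem_undup ?map_f//= eqxx big1 ?addr0//.
by move=> i; rewrite eq_sym => /negbTE ->.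
Qed.

Section unimodular_family.
Variables (I : choiceType) (e : I -> T -> R[i]) (L : set I).
Hypothesis me : forall i, cmeasurable (e i).
Hypothesis e1 : forall i x, sqmod (e i x) = 1.

Let be i : bounded_cmeasurable (e i).
Proof. exact: unimodular_bounded. Qed.

Lemma L2dot_unimodular i : L2dot mu (e i) (e i) = 1.
Proof.
rewrite /L2dot; under eq_fun do rewrite mulcJ e1.
rewrite /cintegral /= !Rintegral_cst//.
by rewrite ![X in fine X](@probability_setT _ _ _ mu) /= mulr1 mul0r.
Qed.

Lemma sqint_unimodular i : sqint mu (e i) = 1%E.
Proof. by rewrite sqint_L2dot// L2dot_unimodular. Qed.

(** Parseval's identity: orthonormality gives Bessel's inequality, totality the
    converse one. *)
Lemma hilbert_basis_parseval j : hilbert_basis mu L e ->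
  (\esum_(i in L) (sqmod (L2dot mu (e j) (e i)))%:E = 1)%E.
Proof.
move=> [[_ _ orth] tot]; have err s (b : I -> R[i]) : uniq s -> [set` s] `<=` L ->
    sqint mu (fun x => e j x - \sum_(i <- s) b i * e i x) =
    (1 - \sum_(i <- s) sqmod (L2dot mu (e j) (e i)) +
      \sum_(i <- s) sqmod (b i - L2dot mu (e j) (e i)))%:E.
  move=> us sL; rewrite mean_square_error ?L2dot_unimodular//.
    by move=> *; exact: L2dot_unimodular.
  by move=> i k /sL Li /sL Lk; exact: orth.
apply/eqP; rewrite eq_le; apply/andP; split.
  apply: esum_le_seq => s us sL.
  have := sqint_ge0 mu (fun x =>
    e j x - \sum_(i <- s) L2dot mu (e j) (e i) * e i x).
  rewrite err// (_ : \sum_(i <- s) sqmod (_ - _) = 0) ?lee_fin; last first.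
    by apply: big1 => i _; rewrite subrr sqmod0.
  by rewrite addr0 subr_ge0.
apply/lee_addgt0Pr => eps eps0.
(* The norm is not squared in the definition of totality. *)
have sq0 : 0 < Num.sqrt eps by rewrite sqrtr_gt0.
have eL2 : L2 mu (e j).
  by split=> //; apply/L2norm_fin; exact: bounded_cmeasurable_sqint.
have [s [c [sL]]] := tot _ eL2 _ sq0.
rewrite L2norm_lt// sqr_sqrtr ?(ltW eps0)//.
have -> : (fun x => e j x - \sum_(i <- s) c i * e i x) =
   (fun x => e j x - \sum_(i <- undup s) ((count_mem i s)%:R * c i) * e i x).
  apply/funext => x; rewrite sum_undup; congr (_ - _).
  by apply: eq_bigr => i _; rewrite mulrA.
have uL : [set` undup s] `<=` L by move=> i; rewrite /= mem_undup => /sL.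
rewrite err ?undup_uniq// lte_fin => lt_eps.
apply: (@le_trans _ _
    ((\sum_(i <- undup s) sqmod (L2dot mu (e j) (e i)))%:E + eps%:E)%E).
  rewrite -EFinD lee_fin.
  have : 0 <= \sum_(i <- undup s)
      sqmod ((count_mem i s)%:R * c i - L2dot mu (e j) (e i)).
    by apply: sumr_ge0 => i _; exact: sqmod_ge0.
  by lra.
by rewrite leeD2r// esum_ge_seq ?undup_uniq.
Qed.

(** At [j] in [L], the term of index [j] already exhausts the sum, so
    the other coefficients vanish.  At an arbitrary [j], the sum
    says that the distance from [e j] to the span of [L] is zero, which passes
    to the closed span of all the [e j]. *)
Lemma parseval_hilbert_basis :
  (forall f, cmeasurable f -> (sqint mu f < +oo)%E ->
    approximable mu setT e f) ->
  (forall j, \esum_(i in L) (sqmod (L2dot mu (e j) (e i)))%:E = 1)%E ->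
  hilbert_basis mu L e.
Proof.
move=> tot sum1.
have orth i j : L i -> L j -> i <> j -> L2dot mu (e i) (e j) = 0.
  move=> Li Lj /eqP ij; apply: sqmod_eq0; apply/eqP.
  rewrite eq_le sqmod_ge0 andbT.
  have : ((\sum_(k <- [:: i; j]) sqmod (L2dot mu (e i) (e k)))%:E <= 1)%E.
    rewrite -(sum1 i); apply: esum_ge_seq; first by rewrite /= inE ij.
    by move=> k /=; rewrite !inE => /orP[]/eqP ->.
  by rewrite !big_cons big_nil L2dot_unimodular sqmod1 lee_fin; lra.
split.
  split=> // [i Li|i _]; last exact: L2dot_unimodular.
  by split=> //; apply/L2norm_fin; exact: bounded_cmeasurable_sqint.
have eL j : approximable mu L e (e j).
  split=> // eps eps0.
  have : ((1 - eps)%:E < \esum_(i in L) (sqmod (L2dot mu (e j) (e i)))%:E)%E.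
    by rewrite sum1 lte_fin gtrBl.
  move=> /esum_gt_seq[s [us sL]]; rewrite lte_fin => lt_s.
  exists [seq (i, L2dot mu (e j) (e i)) | i <- s].
    by move=> _ /mapP[i /sL Li ->].
  have -> : lincomb e [seq (i, L2dot mu (e j) (e i)) | i <- s] =
      (fun x => \sum_(i <- s) L2dot mu (e j) (e i) * e i x).
    by apply/funext => x; rewrite /lincomb big_map.
  rewrite mean_square_error// ?L2dot_unimodular; last 2 first.
  - by move=> i _; exact: L2dot_unimodular.
  - by move=> i k /sL Li /sL Lk; exact: orth.
  rewrite [X in _ + X]big1 ?addr0; last by move=> i _; rewrite subrr sqmod0.
  by rewrite lte_fin /=; lra.
move=> f [mf /L2norm_fin foo] eps eps0.
have [_ fL] : approximable mu L e f.
  apply: (@approximable_ext _ _ _ _ _ _ _ (fun x => 1 * f x)) => [x|].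
    exact: mul1r.
  apply: (approximable_mul (S := setT) (e := e)) => //.
  - by move=> x; rewrite sqmod1.
  - move=> i _; by apply: approximable_ext (eL i) => x; rewrite mul1r.
  - exact: tot.
have [s sL se] := fL _ (exprn_gt0 2 eps0).
exists (undup (map fst s)), (fun i => \sum_(p <- s | p.1 == i) p.2); split.
  by move=> i /=; rewrite mem_undup => /mapP[p /sL Lp ->].
by rewrite L2norm_lt//; move: se; rewrite lincomb_undup.
Qed.

End unimodular_family.

End inner_product.

(** * Ultrametric geometry of a local field *)

Lemma measurable_countable_bigcup d (T : measurableType d) (U : countType)
    (D : set U) (F : U -> set T) :
  (forall i, D i -> measurable (F i)) -> measurable (\bigcup_(i in D) F i).
Proof.
move=> mF; rewrite bigcup_mkcond; apply: countable_bigcupT_measurable.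
  exact: countableP.
by move=> i; case: ifPn => //; rewrite inE => /mF.
Qed.

Lemma measurable_countable_bigcap d (T : measurableType d) (U : countType)
    (D : set U) (F : U -> set T) :
  (forall i, D i -> measurable (F i)) -> measurable (\bigcap_(i in D) F i).
Proof.
move=> mF; rewrite -[X in measurable X]setCK setC_bigcap; apply: measurableC.
by apply: measurable_countable_bigcup => i Di; exact/measurableC/mF.
Qed.

Section absolute_value.
Context {R : realType} {K : topologicalFieldType}.
Variable abs : K -> R.
Hypothesis habs : nonarch_absolute_value abs.

Lemma abs0 : abs 0 = 0.
Proof. exact/(abs_eq0 habs). Qed.

Lemma abs_gt0 x : x != 0 -> 0 < abs x.
Proof.
move=> x0; rewrite lt_neqAle (abs_ge0 habs) andbT eq_sym.
by apply/eqP => /(abs_eq0 habs) xE; rewrite xE eqxx in x0.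
Qed.

Lemma abs1 : abs 1 = 1.
Proof.
have a1 : abs 1 != 0 by rewrite gt_eqF// abs_gt0// oner_neq0.
by apply: (mulfI a1); rewrite -(absM habs) !mulr1.
Qed.

Lemma absX x n : abs (x ^+ n) = abs x ^+ n.
Proof. by elim: n => [|n IH]; rewrite ?expr0 ?abs1// !exprS (absM habs) IH. Qed.

Lemma absN x : abs (- x) = abs x.
Proof.
rewrite -mulN1r (absM habs); suff -> : abs (-1) = 1 by rewrite mul1r.
by apply/eqP; rewrite -sqrp_eq1 ?(abs_ge0 habs)// -absX sqrrN expr1n abs1.
Qed.

Lemma absB x y : abs (x - y) = abs (y - x).
Proof. by rewrite -absN opprB. Qed.

Lemma absV x : abs x^-1 = (abs x)^-1.
Proof.
have [->|x0] := eqVneq x 0; first by rewrite invr0 abs0 invr0.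
have ax : abs x != 0 by rewrite gt_eqF// abs_gt0.
by apply: (mulfI ax); rewrite -(absM habs) !mulfV// abs1.
Qed.

Lemma absD_lt x y e : abs x < e -> abs y < e -> abs (x + y) < e.
Proof.
by move=> xe ye; apply: le_lt_trans (abs_ultrametric habs x y) _; rewrite gt_max xe.
Qed.

Lemma absD_le x y e : abs x <= e -> abs y <= e -> abs (x + y) <= e.
Proof.
by move=> xe ye; apply: le_trans (abs_ultrametric habs x y) _; rewrite ge_max xe.
Qed.

Lemma open_abs_ball x e : open [set y | abs (x - y) < e].
Proof.
rewrite openE => y /= xy; apply/(abs_nbhs habs).
exists e; first exact: le_lt_trans (abs_ge0 habs _) xy.
by move=> z /= yz; rewrite -(subrK y x) -addrA; exact: absD_lt.
Qed.

Section uniformizer.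
Hypothesis hK : nonarch_local_field K.
Variable p : K.
Hypothesis hp : prime_element abs p.

Lemma prime_lt1 : abs p < 1.
Proof.
suff : maximal_ideal abs p by [].
by rewrite hp; exists 1; [rewrite /integer_ring /= abs1|rewrite mulr1].
Qed.

(** Otherwise the open unit balls are points and the field is discrete. *)
Lemma prime_neq0 : p != 0.
Proof.
apply/eqP => p0; case: hK => + _ _; apply => x.
rewrite openE => y -> /=; apply/(abs_nbhs habs); exists 1 => // z xz.
have : maximal_ideal abs (x - z) by [].
by rewrite hp p0 => -[w _]; rewrite mul0r => /esym/subr0_eq ->.
Qed.

Lemma prime_gt0 : 0 < abs p.
Proof. by rewrite abs_gt0// prime_neq0. Qed.

Lemma prime_exp_small (e : R) : 0 < e -> exists n, abs (p ^+ n) < e.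
Proof.
move=> e0; have : (fun n => abs p ^+ n) @ \oo --> (0 : R).
  by apply: cvg_expr; rewrite ger0_norm ?prime_lt1// (abs_ge0 habs).
move=> /cvgrPdist_lt/(_ _ e0)[n _ /(_ n (leqnn n))].
rewrite sub0r normrN ger0_norm ?exprn_ge0 ?(abs_ge0 habs)// => pn.
by exists n; rewrite absX.
Qed.

(** A compact neighbourhood of [0] is covered by finitely many balls of any
    given radius, and its dilations by the powers of [p^-1] exhaust [K]. *)
Lemma local_field_separable : exists q : nat * nat * nat -> K,
  forall x (e : R), 0 < e -> exists j, abs (x - q j) < e.
Proof.
case: hK => _ /(_ 0 I)[C] + [Ccpt _] _.
rewrite /within /= => /(abs_nbhs habs)[r r0 rC].
have cov n : exists s : seq K, forall c, C c ->
    exists2 i, (i < size s)%N & abs (s`_i - c) < abs (p ^+ n).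
  have e0 : 0 < abs (p ^+ n) by rewrite absX exprn_gt0// prime_gt0.
  move: Ccpt; rewrite compact_cover.
  move=> /(_ K setT (fun x => [set y | abs (x - y) < abs (p ^+ n)])) cov.
  have [x _|x _|s _ sC] := cov; first exact: open_abs_ball.
    by exists x => //=; rewrite subrr abs0.
  exists (finmap.enum_fset s) => c /sC[x /= xs xc].
  by exists (index x (finmap.enum_fset s)); rewrite ?index_mem// nth_index.
have [s sP] := choice cov.
(* The triple [(n, k, i)] stands for the dilation by [p ^- n] of the centre
   number [i] of the covering by balls of radius [abs (p ^+ k)]. *)
exists (fun j => p ^- j.1.1 * (s j.1.2)`_j.2) => x e e0.
have [m me] := prime_exp_small e0.
have [n nx] : exists n, abs (p ^+ n * x) < r.
  have [->|x0] := eqVneq x 0; first by exists 0; rewrite mulr0 abs0.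
  have ax := abs_gt0 x0.
  have [|n ne] := @prime_exp_small (r / abs x); first by rewrite divr_gt0.
  by exists n; rewrite (absM habs) -ltr_pdivlMr.
have [|i _ ie] := sP (n + m)%N (p ^+ n * x).
  by apply: rC => //=; rewrite sub0r absN.
exists (n, (n + m)%N, i) => /=; apply: lt_trans me.
have pn0 : p ^+ n != 0 by rewrite expf_neq0// prime_neq0.
rewrite absB -(mulKf pn0 x) -mulrBr (absM habs) absV.
by rewrite ltr_pdivrMl ?abs_gt0// -(absM habs) -exprD.
Qed.

(** * Characters and Borel sets *)

Section character.
Variable chi : K -> R[i].
Hypothesis hchi : additive_character chi.
Hypothesis hchi1 : forall x, integer_ring abs x -> chi x = 1.
Hypothesis hchip : nonconstant_on [set p^-1 * x | x in integer_ring abs] chi.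

Lemma character0 : chi 0 = 1.
Proof. by apply: hchi1; rewrite /integer_ring /= abs0. Qed.

Lemma sqmod_character x : sqmod (chi x) = 1.
Proof. exact/norm1_sqmod/(character_norm hchi). Qed.

Lemma characterN x : chi (- x) = (chi x)^*.
Proof.
have cx : chi x * chi (- x) = 1 by rewrite -(characterD hchi) subrr character0.
have cJ : chi x * (chi x)^* = 1 by rewrite mulcJ sqmod_character.
by rewrite -[LHS]mul1r -cJ mulrAC cx mul1r.
Qed.

Lemma character_near x y : abs (x - y) <= 1 -> chi x = chi y.
Proof.
by move=> xy; rewrite -(subrK y x) (characterD hchi) (hchi1 xy) mul1r.
Qed.

(** Here [z^-1 = p * s] with [s] an integer, so that [s * u * z = p^-1 * u]:
    when [u] runs over the integers, these products fill [p^-1] times the ring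
    of integers, where [chi] is not constant. *)
Lemma character_separates z : 1 < abs z ->
  exists2 y, abs y <= 1 & chi (y * z) <> 1.
Proof.
move=> z1; have z0 : z != 0.
  by apply/eqP => z0; move: z1; rewrite z0 abs0 ltNge ler01.
have : maximal_ideal abs z^-1.
  by rewrite /maximal_ideal /= absV invf_lt1 ?abs_gt0.
rewrite hp => -[s /= s1 psz].
have [x0 [x1 [[u0 u01 <-] [u1 u11 <-] neq]]] := hchip.
exists (s * (u0 - u1)).
  rewrite (absM habs) mulr_ile1 ?(abs_ge0 habs)//.
  by apply: absD_le => //; rewrite absN.
have -> : s * (u0 - u1) * z = p^-1 * u0 - p^-1 * u1.
  rewrite -mulrBr; have -> : z = (p * s)^-1 by rewrite psz invrK.
  have s0 : s != 0.
    apply/eqP => s0; move: psz; rewrite s0 mulr0 => /esym/eqP.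
    by rewrite invr_eq0 (negbTE z0).
  by have p0 := prime_neq0; field; rewrite s0 p0.
rewrite (characterD hchi) characterN => h; apply: neq.
rewrite -[RHS]mul1r -h -mulrA [_^* * _]mulrC mulcJ sqmod_character mulr1//.
Qed.

(** The ring of integers is its own annihilator for the pairing
    [chi (y * z)], and [y] may be restricted to a dense family since [chi] is
    locally constant. *)
Lemma integer_ring_characters (J : Type) (q : J -> K) :
  (forall x (e : R), 0 < e -> exists j, abs (x - q j) < e) ->
  forall z, integer_ring abs z <->
    (forall j, abs (q j) <= 1 -> chi (q j * z) = 1).
Proof.
move=> qd z; split=> [z1 j qj|zq].
  by apply: hchi1; rewrite /integer_ring /= (absM habs) mulr_ile1 ?(abs_ge0 habs).
rewrite /integer_ring /= leNgt; apply/negP => z1.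
have [y y1 yz] := character_separates z1; apply: yz.
have az : 0 < abs z by apply: lt_trans z1.
have [|j yj] := qd y (abs z)^-1; first by rewrite invr_gt0.
have qy : abs (q j) <= 1.
  rewrite -(subrK y (q j)); apply: absD_le => //.
  by rewrite absB (le_trans (ltW yj))// invf_le1// ltW.
rewrite -(zq _ qy); apply: character_near.
by rewrite -mulrBl (absM habs) -ler_pdivlMr// mul1r ltW.
Qed.

Section several_variables.
Variable d : nat.
Local Notation V := 'rV[K]_d.

Lemma dotDl (y z x : V) : dot (y + z) x = dot y x + dot z x.
Proof. by rewrite /dot -big_split; apply: eq_bigr => j _; rewrite mxE mulrDl. Qed.

Lemma dotBr (y x a : V) : dot y (x - a) = dot y x - dot y a.
Proof.
by rewrite /dot -sumrB; apply: eq_bigr => j _; rewrite !mxE mulrBr.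
Qed.

Lemma dotNl (y x : V) : dot (- y) x = - dot y x.
Proof. by rewrite /dot -sumrN; apply: eq_bigr => j _; rewrite mxE mulNr. Qed.

Definition character_fibers : set (set V) :=
  [set A | exists y a : V, A = [set x | chi (dot y (x - a)) = 1]].

Definition polydisc (m : nat) (a : V) : set V :=
  [set x | forall j, abs (x 0 j - a 0 j) <= abs (p ^+ m)].

(** A polydisc is cut out by the conditions that each [(x - a) / p ^+ m] has
    integral coordinates, which are countably many character equations. *)
Lemma polydisc_generated m a : <<s character_fibers >> (polydisc m a).
Proof.
have [q qd] := local_field_separable.
pose D : set ('I_d * (nat * nat * nat)) := [set jk | abs (q jk.2) <= 1].
pose y (jk : 'I_d * (nat * nat * nat)) : V :=
  \row_i (if i == jk.1 then q jk.2 / p ^+ m else 0).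
have pm : 0 < abs (p ^+ m) by rewrite abs_gt0// expf_neq0// prime_neq0.
have -> : polydisc m a = \bigcap_(jk in D) [set x | chi (dot (y jk) (x - a)) = 1].
  have dotE jk x : dot (y jk) (x - a) =
      q jk.2 * ((x 0 jk.1 - a 0 jk.1) / p ^+ m).
    rewrite /dot (bigD1 jk.1)//= big1 => [|i /negbTE ij].
      by rewrite !mxE eqxx addr0 mulrAC mulrA.
    by rewrite mxE ij mul0r.
  have discE x j : abs (x 0 j - a 0 j) <= abs (p ^+ m) <->
      integer_ring abs ((x 0 j - a 0 j) / p ^+ m).
    by rewrite /integer_ring /= (absM habs) absV ler_pdivrMr// mul1r.
  apply/seteqP; split=> x /= xa.
    move=> [j k] Dk /=; rewrite dotE.
    by have /discE/(integer_ring_characters qd) := xa j; exact.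
  move=> j; apply/discE/(integer_ring_characters qd) => k Dk.
  by rewrite -(dotE (j, k)) xa.
apply: (@measurable_countable_bigcap _ (g_sigma_algebraType character_fibers)).
by move=> jk _; apply: sub_sigma_algebra; exists (y jk), a.
Qed.

(** An open set is the union of the polydiscs that it contains and whose centre
    has its coordinates in a countable dense set: in an ultrametric space any
    point of a ball is a centre of it. *)
Lemma open_generated (U : set V) : open U -> <<s character_fibers >> U.
Proof.
move=> oU; have [q qd] := local_field_separable.
pose c (f : {ffun 'I_d -> nat * nat * nat}) : V := \row_j q (f j).
pose D : set ({ffun 'I_d -> nat * nat * nat} * nat) :=
  [set fm | polydisc fm.2 (c fm.1) `<=` U].
have -> : U = \bigcup_(fm in D) polydisc fm.2 (c fm.1).
  apply/seteqP; split=> [x Ux|x [fm Dfm]]; last exact: Dfm.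
  have [P xP PU] : nbhs x U by move: oU; rewrite openE; exact.
  have /choice[n nP] : forall j, exists n,
      [set y | abs (x 0 j - y) <= abs (p ^+ n)] `<=` P 0 j.
    move=> j; have /(abs_nbhs habs)[e e0 eP] := xP 0 j.
    have [n ne] := prime_exp_small e0.
    by exists n => y /= xy; apply: eP; exact: le_lt_trans xy ne.
  pose m := \max_j n j.
  have /choice[f fx] : forall j, exists k, abs (x 0 j - q k) < abs (p ^+ m).
    by move=> j; apply: qd; rewrite abs_gt0// expf_neq0// prime_neq0.
  have xc : polydisc m (c (finfun f)) x by move=> j; rewrite mxE ffunE ltW.
  exists (finfun f, m) => // z zc; apply: PU => i j; rewrite (ord1 i).
  apply: nP => /=; apply: (@le_trans _ _ (abs (p ^+ m))).
    rewrite -(subrK (c (finfun f) 0 j) (x 0 j)) -addrA; apply: absD_le => //.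
    by rewrite absB.
  rewrite !absX; apply: ler_wiXn2l; rewrite ?(abs_ge0 habs) ?(ltW prime_lt1)//.
  exact: leq_bigmax.
apply: (@measurable_countable_bigcup _ (g_sigma_algebraType character_fibers)).
by move=> fm _; exact: polydisc_generated.
Qed.

(** The character is constant on the polydisc of radius [abs (p ^+ n)] around
    each point as soon as all [y 0 j * p ^+ n] are integers. *)
Lemma open_vchar_preimage (y : V) (A : set R[i]) :
  open (vchar chi y @^-1` A).
Proof.
rewrite openE => x Ax.
have [n ny] : exists n, forall j, abs (y 0 j * p ^+ n) <= 1.
  have /choice[n nP] : forall j, exists n, abs (y 0 j * p ^+ n) <= 1.
    move=> j; have [->|y0] := eqVneq (y 0 j) 0.
      by exists 0; rewrite mul0r abs0.
    have ay := abs_gt0 y0.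
    have [|n ne] := @prime_exp_small (abs (y 0 j))^-1; first by rewrite invr_gt0.
    by exists n; rewrite (absM habs) -ler_pdivlMl// mulr1 ltW.
  exists (\max_j n j) => j; apply: le_trans (nP j).
  rewrite !(absM habs) ler_wpM2l ?(abs_ge0 habs)// !absX.
  by apply: ler_wiXn2l; rewrite ?(abs_ge0 habs) ?(ltW prime_lt1)// leq_bigmax.
have pn : 0 < abs (p ^+ n) by rewrite abs_gt0// expf_neq0// prime_neq0.
exists (fun i j => [set z | abs (x i j - z) < abs (p ^+ n)]).
  by move=> i j; apply/(abs_nbhs habs); exists (abs (p ^+ n)).
move=> z xz /=; rewrite /vchar -(character_near (x := dot y x))//.
rewrite -dotBr /dot; elim/big_ind : _ => [|a b|j _].
- by rewrite abs0.
- exact: absD_le.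
- rewrite !mxE (absM habs) (le_trans _ (ny j))// (absM habs).
  by rewrite ler_wpM2l ?(abs_ge0 habs)// ltW// xz.
Qed.

Lemma measurable_vchar_preimage (y : V) (A : set R[i]) :
  @measurable _ (borel V) (vchar chi y @^-1` A).
Proof. by apply: sub_sigma_algebra; exact: open_vchar_preimage. Qed.

Lemma cmeasurable_vchar (y : V) :
  cmeasurable (vchar chi y : borel V -> R[i]).
Proof.
split=> _ Y _; rewrite setTI.
  exact: (measurable_vchar_preimage y [set w | Y (complex.Re w)]).
exact: (measurable_vchar_preimage y [set w | Y (complex.Im w)]).
Qed.

Lemma vcharD (y z x : V) : vchar chi (y + z) x = vchar chi y x * vchar chi z x.
Proof. by rewrite /vchar dotDl (characterD hchi). Qed.

Lemma vcharN (y x : V) : vchar chi (- y) x = (vchar chi y x)^*.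
Proof. by rewrite /vchar dotNl characterN. Qed.

(** Multiplication by a character preserves the closed span of the characters,
    hence so does multiplication by the indicator of any set in the
    sigma-algebra generated by the fibres of the characters, that is, of any
    Borel set. *)
Lemma vchar_total (mu : {measure set (borel V) -> \bar R}) :
  (forall y, sqint mu (vchar chi y) < +oo)%E ->
  forall f, cmeasurable f -> (sqint mu f < +oo)%E ->
  approximable mu setT (fun y : V => vchar chi y) f.
Proof.
move=> fin.
have mv := cmeasurable_vchar; have fin' y (_ : setT y) := fin y.
have app_mul y f : approximable mu setT (fun y : V => vchar chi y) f ->
    approximable mu setT (fun y : V => vchar chi y) (fun x => vchar chi y x * f x).
  apply: approximable_mul => // [x|z _]; first by rewrite sqmod_character.
  have := approximable_gen mu mv (I : setT (y + z)).
  by apply: approximable_ext => x; rewrite vcharD.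
apply: (stable_total mv).
  apply: approximable_ext (approximable_gen mu mv (I : setT 0)) => x.
  by rewrite /vchar /dot big1 ?character0// => j _; rewrite mxE mul0r.
have sA := stable_sigma_algebra mv fin'.
move=> A; apply: smallest_sub; first exact: sA.
move=> U oU; apply: (smallest_sub sA _ (open_generated oU)) => _ [y [a ->]].
have chE x : chi (dot y (x - a)) = (chi (dot y a))^* * vchar chi y x.
  by rewrite dotBr (characterD hchi) characterN mulrC.
apply: stable_eq1 => //.
- under eq_fun do rewrite chE; apply: cmeasurableM => //; exact: cmeasurable_cst.
- by move=> x; rewrite sqmod_character.
- move=> f af; under eq_fun do rewrite chE -mulrA.
  by apply: approximableZ => //; exact: app_mul.
- have -> : [set x | chi (dot y (x - a)) = 1] =
      vchar chi y @^-1` [set w | (chi (dot y a))^* * w = 1].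
    by apply/seteqP; split=> x /=; rewrite chE.
  exact: measurable_vchar_preimage.
Qed.

End several_variables.
End character.
End uniformizer.
End absolute_value.

Theorem theorem1p1 (R : realType) (K : topologicalFieldType)
    (hK : nonarch_local_field K)
    (abs : K -> R) (habs : nonarch_absolute_value abs)
    (p : K) (hp : prime_element abs p)
    (chi : K -> R[i]) (hchi : additive_character chi)
    (hchi1 : forall x, integer_ring abs x -> chi x = 1)
    (hchip : nonconstant_on [set p^-1 * x | x in integer_ring abs] chi)
    (d : nat) (hd : (0 < d)%N)
    (mu : probability (borel 'rV[K]_d) R)
    (Lambda : set 'rV[K]_d) :
  spectrum chi mu Lambda <->
  (forall xi : 'rV[K]_d,
    (\esum_(lambda in Lambda) ((modulus (fourier chi mu (lambda - xi))) ^+ 2)%:E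
      = 1)%E).
Proof.
have mv y : cmeasurable (vchar chi y : borel 'rV[K]_d -> R[i]).
  exact: (cmeasurable_vchar habs hK hp hchi hchi1).
have v1 (y x : 'rV[K]_d) : sqmod (vchar chi y x) = 1.
  exact: (sqmod_character hchi).
have dotE xi lambda :
    L2dot mu (vchar chi xi) (vchar chi lambda) = fourier chi mu (lambda - xi).
  congr cintegral; apply/funext => x.
  by rewrite (vcharD hchi) (vcharN habs hchi hchi1) cJM conjCK mulrC.
have sumE xi : (\esum_(lambda in Lambda)
      ((modulus (fourier chi mu (lambda - xi))) ^+ 2)%:E =
    \esum_(lambda in Lambda)
      (sqmod (L2dot mu (vchar chi xi) (vchar chi lambda)))%:E)%E.
  by apply: eq_esum => lambda _; rewrite dotE sqr_modulus.
split=> [basis xi|sum1].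
  by rewrite sumE; exact: (hilbert_basis_parseval mv v1 xi basis).
apply: (parseval_hilbert_basis mv v1) => [f mf foo|xi]; last by rewrite -sumE.
apply: (vchar_total habs hK hp hchi hchi1 hchip) => // y.
by rewrite (sqint_unimodular mu mv v1) ltry.
Qed.
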